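(* For every $\gamma>0$ there exists a constant $C=C(\gamma)>0$ such that for all $p\ge Cn^{-2/3}\log^{1/3}n$, w.h.p.\ the random graph $\Gamma\sim G_{n,p}$ contains a spanning subgraph $G\subseteq\Gamma$ in which every vertex is contained in at least $(4/9-\gamma)\binom n2p^3$ triangles and such that $G$ does not contain a family of more than $(1-\gamma)n/3$ vertex-disjoint triangles.
   Context: $G_{n,p}$ is the random graph on $[n]$ with each edge present independently with probability $p$; w.h.p.\ means with probability tending to $1$ as $n\to\infty$; $\log$ is natural. *)

(* Defs.v *)
From HB Require Import structures.
From mathcomp Require Import all_boot all_order all_algebra.
From mathcomp Require Import all_classical all_reals all_analysis.

Set Implicit Arguments.
Unset Strict Implicit.
Unset Printing Implicit Defensive.

Import Order.TTheory GRing.Theory Num.Theory.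
Import numFieldNormedType.Exports.

Local Open Scope ring_scope.

Section Graphs.
Variable n : nat.

(* A simple graph on the vertex set 'I_n is represented by its edge set,
   a set of 2-element sets of vertices, that is, a subset of vpairs. *)
Definition vpairs : {set {set 'I_n}} := [set e : {set 'I_n} | #|e| == 2%N].

(* Triangles are identified with their vertex sets. *)
Definition triangles (G : {set {set 'I_n}}) : {set {set 'I_n}} :=
  [set t : {set 'I_n} | (#|t| == 3%N) &&
     [forall e : {set 'I_n}, (e \in vpairs) && (e \subset t) ==> (e \in G)]].

Definition triangles_at (G : {set {set 'I_n}}) (v : 'I_n) : {set {set 'I_n}} :=
  [set t in triangles G | v \in t].

(* Families are nonempty: when x < 0 the empty family would otherwise have
   more than x members, and no graph at all could avoid it.  For 0 <= x the
   condition F != set0 follows from x < #|F|. *)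
Definition has_disjoint_triangles_gt (R : realType) (G : {set {set 'I_n}})
    (x : R) : bool :=
  [exists F : {set {set 'I_n}},
    [&& F != finset.set0, F \subset triangles G, finset.trivIset F & x < #|F|%:R]].

End Graphs.

Arguments vpairs : clear implicits.

Definition gnp_weight (R : realType) (n : nat) (p : R)
    (E : {set {set 'I_n}}) : R :=
  \prod_(e in vpairs n) (if e \in E then p else 1 - p).

(* Probability that the random graph G_{n,p} has the property A. *)
Definition gnp_prob (R : realType) (n : nat) (p : R)
    (A : pred {set {set 'I_n}}) : R :=
  \sum_(E in powerset (vpairs n) | A E) gnp_weight p E.

(* The event A n has probability tending to 1 in G_{n, p n}. *)
Definition whp (R : realType) (p : nat -> R)
    (A : forall n : nat, pred {set {set 'I_n}}) : Prop :=
  ((fun n : nat => gnp_prob (p n) (A n)) @ \oo --> (1 : R))%classic.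

(* The edges are present independently with probability p; the case F empty
   says that the weights sum to 1. *)
Lemma gnp_prob_subset (R : realType) (n : nat) (p : R) (F : {set {set 'I_n}}) :
  F \subset vpairs n -> gnp_prob p (fun E => F \subset E) = p ^+ #|F|.
Proof.
move=> FV.
pose a e : R := if e \in vpairs n then p else 0.
pose b e : R := if e \in vpairs n then (if e \in F then 0 else 1 - p) else 1.
transitivity (\prod_e (a e + b e)); last first.
  rewrite (bigID (mem F)) /= [X in _ * X]big1 ?mulr1.
    rewrite -prodr_const; apply: eq_bigr => e eF.
    by rewrite /a /b (fintype.subsetP FV _ eF) eF addr0.
  by move=> e /negbTE eF; rewrite /a /b eF; case: ifP => _; rewrite ?add0r// subrKC.
rewrite bigA_distr /gnp_prob [RHS](bigID [pred E : {set {set 'I_n}} |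
  (E \in powerset (vpairs n)) && (F \subset E)]) /= [X in _ + X]big1 ?addr0.
  apply: eq_bigr => E /andP[]; rewrite powersetE => EV FE.
  rewrite /gnp_weight [RHS](bigID (mem (vpairs n))) /= [X in _ * X]big1 ?mulr1.
    apply: eq_bigr => e eV; rewrite /a /b eV; case: ifPn => // eE.
    by rewrite ifN//; apply: contra eE; exact: (fintype.subsetP FE).
  move=> e eV; rewrite /a /b (negbTE eV) ifN//.
  by apply: contra eV; exact: (fintype.subsetP EV).
move=> E; rewrite powersetE negb_and => /orP[] /fintype.subsetPn[e].
  by move=> eE eV; rewrite (bigD1 e)//= eE /a (negbTE eV) mul0r.
move=> eF eE; rewrite (bigD1 e)//= (negbTE eE) /b eF (fintype.subsetP FV _ eF).
by rewrite mul0r.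
Qed.

(* Main.v *)
(** Let B be a set of about 2(1 - gamma)n/3 vertices and let G be Gamma without
    the edges inside the complement of B.  Every triangle of G has at least two
    vertices in B, so disjoint triangles number at most |B|/2.

    A vertex v lies in G on all triangles v u w of Gamma with u, w in B.  Reveal
    first the edges from v to B: v has about p|B| neighbours there.  The edges
    of Gamma inside this neighbourhood are then independent of what was
    revealed, and about p(p|B|)^2/2 of them are present.  Both lower tails are
    Chernoff bounds; n^2 p^3 >= C^3 log n makes them at most n^-2 each, which
    leaves room for a union bound over v.  When gamma >= 4/9 the empty graph
    works. *)

Require Import Defs.
From HB Require Import structures.
From mathcomp Require Import all_boot all_order all_algebra.
From mathcomp Require Import all_classical all_reals all_analysis.
From mathcomp Require Import fintype finset ring lra zify.

Set Implicit Arguments.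
Unset Strict Implicit.
Unset Printing Implicit Defensive.

Import Order.TTheory GRing.Theory Num.Theory.
Import numFieldNormedType.Exports.

Local Open Scope ring_scope.

(** * Expectations over a random subset and the Chernoff lower tail *)

Section RandomSubset.
Variables (R : realType) (T : finType) (p : R).
Implicit Types (U S D E : {set T}) (f g : {set T} -> R).

(* Expectation of f over the random subset of U that contains each element
   independently with probability p. *)
Definition bexp U f : R :=
  \sum_(E in powerset U) (\prod_(e in U) (if e \in E then p else 1 - p)) * f E.

Lemma sum_powerset_prod U (a c : T -> R) :
  \sum_(E in powerset U) \prod_(e in U) (if e \in E then a e else c e)
  = \prod_(e in U) (a e + c e).
Proof.
(* The weights [0] and [1] off [U] turn the sum into one over all sets, where [bigA_distr]
   applies. *)
pose a' e : R := if e \in U then a e else 0.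
pose c' e : R := if e \in U then c e else 1.
transitivity (\prod_e (a' e + c' e)); last first.
  rewrite [RHS]big_mkcond; apply: eq_bigr => e _.
  by rewrite /a' /c'; case: ifP; rewrite ?add0r.
rewrite bigA_distr [RHS](bigID (mem (powerset U))) /= [X in _ + X]big1 ?addr0.
  apply: eq_bigr => E; rewrite powersetE => EU.
  rewrite [LHS]big_mkcond; apply: eq_bigr => e _; rewrite /a' /c'.
  case: (boolP (e \in U)) => // eU.
  by rewrite ifN//; apply: contra eU; exact: (subsetP EU).
move=> E; rewrite powersetE => /subsetPn[e eE eU].
by rewrite (bigD1 e)//= eE /a' (negbTE eU) mul0r.
Qed.

Lemma bexp_cst U (c : R) : bexp U (fun=> c) = c.
Proof.
rewrite /bexp -mulr_suml sum_powerset_prod big1 ?mul1r// => e _.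
by rewrite addrC subrK.
Qed.

Lemma bexpZ U (c : R) f : bexp U (fun E => c * f E) = c * bexp U f.
Proof. by rewrite /bexp mulr_sumr; apply: eq_bigr => E _; rewrite mulrCA. Qed.

Lemma bexpD U f g : bexp U (fun E => f E + g E) = bexp U f + bexp U g.
Proof. by rewrite /bexp -big_split; apply: eq_bigr => E _; rewrite mulrDr. Qed.

Lemma bexp_sum (I : finType) U (F : I -> {set T} -> R) :
  bexp U (fun E => \sum_i F i E) = \sum_i bexp U (F i).
Proof.
by rewrite /bexp exchange_big; apply: eq_bigr => E _; rewrite mulr_sumr.
Qed.

(** Generating function of a binomial variable: the weight factors over [U], and an element outside
    [D] contributes [p + (1 - p) = 1]. *)
Lemma bexp_pow_card U D (x : R) : D \subset U ->
  bexp U (fun E => x ^+ #|E :&: D|) = (1 - p * (1 - x)) ^+ #|D|.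
Proof.
move=> DU.
transitivity (\prod_(e in U) (p * (if e \in D then x else 1) + (1 - p))).
  rewrite -sum_powerset_prod; apply: eq_bigr => E; rewrite powersetE => EU.
  rewrite -prodr_const big_mkcond [X in _ * X]big_mkcond [RHS]big_mkcond.
  rewrite -big_split /=; apply: eq_bigr => e _; rewrite inE.
  case: (boolP (e \in U)) => eU.
    by case: (e \in E); case: (e \in D); rewrite ?mulr1.
  by rewrite ifN ?mulr1// negb_and (contra (subsetP EU e) eU).
rewrite (bigID (mem D)) /= [X in _ * X]big1 ?mulr1; last first.
  by move=> e /andP[_ /negbTE->]; rewrite mulr1 addrC subrK.
rewrite -prodr_const; apply: eq_big => e.
  by case: (boolP (e \in D)) => eD; rewrite ?andbT ?andbF ?(subsetP DU).
by move=> /andP[_ ->]; ring.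
Qed.

(** Independence of the parts in [S] and off [S]: [E] corresponds to the pair [(E :&: S, E :\: S)],
    and its weight is the product of theirs. *)
Lemma bexp_split U S f : S \subset U ->
  bexp U f = bexp S (fun E1 => bexp (U :\: S) (fun E2 => f (E1 :|: E2))).
Proof.
move=> SU; rewrite /bexp.
under [RHS]eq_bigr do rewrite mulr_sumr.
rewrite pair_big_dep /=.
rewrite (reindex_onto (fun E : {set T} * {set T} => E.1 :|: E.2)
  (fun E : {set T} => (E :&: S, E :\: S))) /=; last by move=> E _; rewrite setID.
apply: eq_big => [[E1 E2]|[E1 E2]] /=.
  rewrite !powersetE; apply/andP/andP => /= [[EU /eqP[h1 h2]]|[E1S]].
    by split; [rewrite -h1 subsetIr | rewrite -h2 finset.setSD].
  rewrite subsetD => /andP[E2U E2S].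
  rewrite subUset (subset_trans E1S SU) E2U; split=> //; apply/eqP.
  rewrite finset.setIUl finset.setDUl (setIidPl E1S) (setDidPl E2S).
  have /eqP-> : E1 :\: S == finset.set0 by rewrite setD_eq0.
  by rewrite disjoint_setI0// finset.setU0 finset.set0U.
rewrite powersetE => /andP[_ /eqP[h1 h2]].
rewrite mulrA; congr (_ * _); rewrite (bigID (mem S)) /=; congr (_ * _).
  apply: eq_big => e.
    by case: (boolP (e \in S)) => eS; rewrite ?andbT ?andbF ?(subsetP SU).
  by move=> /andP[_ eS]; rewrite -[in RHS]h1 !inE eS andbT.
apply: eq_big => e; first by rewrite inE andbC.
by move=> /andP[_ eS]; rewrite -[in RHS]h2 !inE eS.
Qed.

Hypotheses (p_ge0 : 0 <= p) (p_le1 : p <= 1).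

Lemma le_bexp U f g :
  (forall E, E \subset U -> f E <= g E) -> bexp U f <= bexp U g.
Proof.
move=> fg; apply: ler_sum => E; rewrite powersetE => EU.
apply: ler_wpM2l (fg E EU); apply: prodr_ge0 => e _.
by case: ifP; rewrite ?subr_ge0.
Qed.

(** Exponential Markov inequality: the indicator is at most [expR (t * (m - #|E :&: D|))], whose
    expectation comes from the generating function at [expR (- t)]. *)
Lemma binomial_lower_tail U D (eps : R) : D \subset U -> 0 <= eps ->
  bexp U (fun E => (#|E :&: D|%:R < (1 - eps) * p * #|D|%:R)%R%:R)
  <= expR (- (eps ^+ 2 / 4 * (p * #|D|%:R))).
Proof.
(* Once [1 - x >= t - t ^+ 2] is known, the exponent is [(t ^+ 2 - eps * t) * (p * #|D|)], smallest
   at [t = eps / 2]. *)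
move=> DU eps0; pose t := eps / 2; pose x := expR (- t).
have t0 : 0 <= t by rewrite divr_ge0.
pose m := (1 - eps) * p * #|D|%:R.
apply: (@le_trans _ _ (bexp U (fun E => expR (t * m) * x ^+ #|E :&: D|))).
  apply: le_bexp => E _; case: ltP => [lt_m|_] /=; last first.
    by rewrite mulr_ge0 ?exprn_ge0 ?expR_ge0.
  rewrite -expRM_natl -expRD -[leLHS]expR0 ler_expR.
  have -> : t * m + #|E :&: D|%:R * - t = t * (m - #|E :&: D|%:R) by ring.
  by rewrite mulr_ge0// subr_ge0 ltW.
rewrite bexpZ bexp_pow_card//.
have x01 : t - t ^+ 2 <= 1 - x.
  have x1 : x * (1 + t) <= 1.
    rewrite -[leRHS](expRxMexpNx_1 t) mulrC ler_wpM2r ?expR_ge0//.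
    exact: expR_ge1Dx.
  have x0 : 0 <= x by exact: expR_ge0.
  have : x <= 1 - t + t ^+ 2.
    have -> : x = x * (1 + t) - x * (1 + t) * t + x * t ^+ 2 by ring.
    have x1' : x <= 1 by rewrite -expR0 ler_expR oppr_le0.
    have := sqr_ge0 t; nra.
  by move=> h; lra.
have base : 0 <= 1 - p * (1 - x) <= expR (- (p * (t - t ^+ 2))).
  have x0 : 0 <= x by exact: expR_ge0.
  apply/andP; split.
    rewrite mulrBr mulr1 opprB addrCA addr_ge0 ?mulr_ge0 ?subr_ge0//.
  by apply: le_trans (expR_ge1Dx _); rewrite lerD2l lerN2 ler_wpM2l.
case/andP: base => base0 base1.
apply: (@le_trans _ _ (expR (t * m) * expR (- (p * (t - t ^+ 2))) ^+ #|D|)).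
  by rewrite ler_wpM2l ?expR_ge0// lerXn2r ?nnegrE ?expR_ge0.
rewrite -expRM_natl -expRD ler_expR -mulr_natr /m /t le_eqVlt.
by apply/orP; left; apply/eqP; field.
Qed.

End RandomSubset.

(** * Links of a vertex and their lower tail *)

Section Links.
Variable n : nat.
Implicit Types (v u : 'I_n) (W N : {set 'I_n}) (E : {set {set 'I_n}}).

Definition star v W : {set {set 'I_n}} := [set [set v; u] | u in W].

Definition nbrs E v W : {set 'I_n} := [set u in W | [set v; u] \in E].

Definition pairs_in N : {set {set 'I_n}} :=
  [set e : {set 'I_n} | e \subset N & #|e| == 2%N].

(** For [v] outside [W], the members correspond to the triangles [v u w] of [E] with [u] and [w] in
    [W]. *)
Definition link E v W : {set {set 'I_n}} := E :&: pairs_in (nbrs E v W).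

Lemma set2_inj v W : v \notin W -> {in W &, injective (fun u => [set v; u])}.
Proof.
move=> vW u w uW _ /setP/(_ u); rewrite !inE eqxx orbT.
have /negbTE-> : u != v by apply: contraNneq vW => <-.
by move=> /esym/eqP.
Qed.

Lemma star_vpairs v W : v \notin W -> star v W \subset vpairs n.
Proof.
move=> vW; apply/subsetP => _ /imsetP[u uW ->].
by rewrite inE cards2 (_ : v != u)//; apply: contraNneq vW => ->.
Qed.

Lemma card_star v W : v \notin W -> #|star v W| = #|W|.
Proof. by move=> vW; rewrite card_in_imset//; exact: set2_inj. Qed.

Lemma card_nbrs E v W :
  v \notin W -> E \subset star v W -> #|nbrs E v W| = #|E|.
Proof.
move=> vW ES; rewrite -(@card_star v); last by rewrite inE (negbTE vW).
congr #|pred_of_set _|; apply/setP => e; apply/imsetP/idP => [[u]|eE].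
  by rewrite inE => /andP[_ ?] ->.
have /imsetP[u uW eu] := subsetP ES _ eE.
by exists u => //; rewrite inE uW -eu.
Qed.

Lemma pairs_in_vpairsD v W N : v \notin W -> N \subset W ->
  pairs_in N \subset vpairs n :\: star v W.
Proof.
move=> vW NW; apply/subsetP => e; rewrite !inE => /andP[eN ->]; rewrite andbT.
apply/imsetP => -[u uW eu]; have : v \in e by rewrite eu !inE eqxx.
by move=> /(subsetP eN) /(subsetP NW); rewrite (negbTE vW).
Qed.

Lemma card_pairs_in N : #|pairs_in N| = 'C(#|N|, 2).
Proof. exact: cards_draws. Qed.

Lemma nbrsU E1 E2 v W : E2 \subset vpairs n :\: star v W ->
  nbrs (E1 :|: E2) v W = nbrs E1 v W.
Proof.
move=> E2S; apply/setP => u; rewrite !inE.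
case: (boolP (u \in W)) => //= uW; case: (boolP (_ \in E1)) => //= _.
apply/negbTE/negP => /(subsetP E2S); rewrite inE => /andP[/negP + _].
by apply; apply/imsetP; exists u.
Qed.

(* Reveal the star at v first; the pairs inside the neighbourhood it determines
   lie outside the star, so they are still independent. *)
Lemma link_lower_tail (R : realType) (p : R) v W (eps M : R) :
  0 <= p <= 1 -> 0 <= eps <= 1 -> v \notin W ->
  (forall k : nat, (1 - eps) * p * #|W|%:R <= k%:R -> M <= 'C(k, 2)%:R) ->
  bexp p (vpairs n) (fun E => (#|link E v W|%:R < (1 - eps) * p * M)%R%:R)
  <= expR (- (eps ^+ 2 / 4 * (p * #|W|%:R))) + expR (- (eps ^+ 2 / 4 * (p * M))).
Proof.
move=> /andP[p0 p1] /andP[eps0 eps1] vW hM.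
rewrite (bexp_split _ _ (star_vpairs vW)).
set e2 := expR (- (eps ^+ 2 / 4 * (p * M))).
have := binomial_lower_tail p0 p1 (subxx (star v W)) eps0.
rewrite card_star// => tail.
apply: le_trans (lerD tail (lexx e2)).
rewrite -[X in _ <= _ + X](bexp_cst p (star v W)) -bexpD; apply: le_bexp => // E1 E1S.
have e20 : 0 <= e2 by exact: expR_ge0.
(* If [v] has too few neighbours, the inner expectation is bounded by [1] and charged to the first
   tail; otherwise the second tail bounds it. *)
rewrite (setIidPl E1S); case: ltP => [_|hE1] /=.
  apply: (@le_trans _ _ 1); last by rewrite lerDl.
  rewrite -[leRHS](bexp_cst p (vpairs n :\: star v W)).
  by apply: le_bexp => // E _; case: (_ < _).
rewrite add0r; pose D := pairs_in (nbrs E1 v W).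
have DU : D \subset vpairs n :\: star v W.
  by apply: pairs_in_vpairsD => //; apply/subsetP => u; rewrite inE => /andP[].
have DM : M <= #|D|%:R by rewrite card_pairs_in card_nbrs// hM.
(* [E2 :&: D] is part of the link and [M <= #|D|], so a small link forces a lower deviation of
   [#|E2 :&: D|]. *)
apply: le_trans (le_trans (binomial_lower_tail p0 p1 DU eps0) _).
  apply: le_bexp => // E2 E2S; rewrite ler_nat /link nbrsU//.
  case: ltP => // lt_l; rewrite lt0b; apply: (le_lt_trans _ (lt_le_trans lt_l _)).
    by rewrite ler_nat subset_leq_card// finset.setSI// finset.subsetUr.
  by rewrite ler_wpM2l// mulr_ge0// subr_ge0.
by rewrite ler_expR lerN2 !ler_wpM2l// divr_ge0// exprn_ge0.
Qed.

End Links.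

(** * The subgraph of edges meeting [B]: disjoint triangles and triangles at a vertex *)

Section Cut.
Variable n : nat.
Implicit Types (v u : 'I_n) (B : {set 'I_n}) (E F : {set {set 'I_n}}).

Definition meeting B E : {set {set 'I_n}} := [set e in E | ~~ [disjoint e & B]].

(** Two vertices of the triangle outside [B] would span one of its edges, but that edge has been
    removed. *)
Lemma triangle_meeting B E (t : {set 'I_n}) :
  t \in triangles (meeting B E) -> (2 <= #|t :&: B|)%N.
Proof.
rewrite inE => /andP[/eqP t3 /forallP tE]; rewrite leqNgt; apply/negP => tB.
have /card_geqP[s [su s2 sA]] : (2 <= #|t :\: B|)%N.
  by have := finset.cardsID B t; lia.
pose e := [set x in s].
have eA : e \subset t :\: B by apply/subsetP => x; rewrite inE; exact: sA.
have := tE e; rewrite !inE cardsE (card_uniqP su) s2 eqxx.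
have := eA; rewrite subsetD => /andP[-> ->].
by rewrite andbF.
Qed.

(** Count the vertices of [B] covered by the family: each triangle uses at least two, and none is
    shared. *)
Lemma card_disjoint_triangles B E F :
  F \subset triangles (meeting B E) -> trivIset F -> (2 * #|F| <= #|B|)%N.
Proof.
move=> FE trF; apply: (@leq_trans (\sum_(t in F) #|t :&: B|)%N).
  rewrite mulnC -sum_nat_const; apply: leq_sum => t tF.
  exact: triangle_meeting (subsetP FE t tF).
rewrite -[leqRHS]sum1_card [leqRHS]big_mkcond /=.
apply: (@leq_trans (\sum_(x in cover F) (x \in B))%N).
  rewrite big_trivIset//; apply: leq_sum => t _.
  rewrite -sum1_card [leqLHS]big_mkcond [leqRHS]big_mkcond /=.
  by apply: leq_sum => x _; rewrite !inE; case: (x \in t); case: (x \in B).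
rewrite big_mkcond; apply: leq_sum => x _.
by case: (x \in cover F); case: (x \in B).
Qed.

(** The map sending [e] to [v |: e] is injective on the link, as no [e] contains [v]; taking
    [B :\ v] ensures this also when [v] is in [B]. *)
Lemma card_link_triangles_at B E v :
  (#|link E v (B :\ v)| <= #|triangles_at (meeting B E) v|)%N.
Proof.
set L := link _ _ _.
have LP e : e \in L -> [/\ e \in E, e \subset B :\ v, #|e| == 2%N &
    forall u, u \in e -> [set v; u] \in E].
  rewrite !inE => /and3P[eE /subsetP eN ->]; split => //.
    by apply/subsetP => u /eN; rewrite inE => /andP[].
  by move=> u /eN; rewrite inE => /andP[].
have vL e : e \in L -> v \notin e.
  by move=> /LP[_ /subsetP eB _ _]; apply/negP => /eB; rewrite !inE eqxx.
rewrite -(@card_in_imset _ _ (fun e => v |: e) L); last first.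
  by move=> e f /vL ve /vL vf ef; rewrite -(setU1K ve) ef setU1K.
apply/subset_leq_card/subsetP => _ /imsetP[e eL ->].
have [eE /subsetP eB /eqP e2 vE] := LP e eL; have ve := vL e eL.
rewrite !inE eqxx andbT cardsU1 ve e2 /=; apply/forallP => f.
apply/implyP; rewrite !inE => /andP[/eqP f2 fve].
have eBn u : u \in e -> ~~ [disjoint e & B].
  move=> ue; apply/pred0Pn; exists u => /=; rewrite ue.
  by have := eB u ue; rewrite !inE => /andP[].
(* An edge of the triangle through [v] has its other end in [e], hence in [B]; the only edge
   avoiding [v] is [e] itself. *)
case: (boolP (v \in f)) => vf.
  have /cards1P[u fu] : #|f :\ v| == 1%N by have := cardsD1 v f; rewrite vf f2 add1n => -[<-].
  have ue : u \in e.
    have : u \in f :\ v by rewrite fu inE.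
    by rewrite !inE => /andP[uv /(subsetP fve)]; rewrite !inE (negbTE uv).
  rewrite -(finset.setD1K vf) fu vE//=; apply/pred0Pn; exists u.
  by rewrite /= !inE eqxx orbT/=; have := eB u ue; rewrite !inE => /andP[].
have -> : f = e.
  apply/eqP; rewrite eqEcard f2 e2 leqnn andbT; apply/subsetP => u uf.
  have := subsetP fve u uf; rewrite !inE => /orP[/eqP uv|//].
  by move: vf; rewrite -uv uf.
rewrite eE /=; have /card_gt0P[u ue] : (0 < #|e|)%N by rewrite e2.
exact: eBn ue.
Qed.

End Cut.

(** * The lower tail for the triangles at one vertex *)

Lemma natr_bin2 (R : realType) (k : nat) :
  'C(k, 2)%:R = k%:R * (k%:R - 1) / 2 :> R.
Proof.
case: k => [|k]; first by rewrite mul0r mul0r.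
apply: (@mulIf R 2); first by rewrite pnatr_eq0.
rewrite divfK ?pnatr_eq0// -[in RHS]natr1 addrK natr1 -!natrM mulnC.
by rewrite -mul_bin_diag bin1.
Qed.

(** The [- 1] makes [b] a lower bound for [#|B :\ v|] even when [v] is in [B]; [M] is then a lower
    bound for the number of pairs of neighbours. *)
Lemma vertex_tail (R : realType) (n : nat) (p : R) (B : {set 'I_n}) (v : 'I_n)
    (eps b : R) (M := (1 - eps) * (1 - 2 * eps) * (p * b) ^+ 2 / 2) :
  0 <= p <= 1 -> 0 <= eps <= 1 / 2 -> 1 <= eps * (p * b) -> b <= #|B|%:R - 1 ->
  bexp p (vpairs n) (fun E =>
    (#|triangles_at (meeting B E) v|%:R < (1 - eps) * p * M)%R%:R)
  <= expR (- (eps ^+ 2 / 4 * (p * b))) + expR (- (eps ^+ 2 / 4 * (p * M))).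
Proof.
move=> p01 /andP[eps0 eps1] pb bB; have /andP[p0 p1] := p01.
have vW : v \notin B :\ v by rewrite !inE eqxx.
have bW : b <= #|B :\ v|%:R.
  apply: le_trans bB _; rewrite lerBlDr natr1 ler_nat.
  by rewrite (cardsD1 v B) -add1n leq_add2r leq_b1.
(* As [1 <= eps * (p * b)], the bound [k >= (1 - eps) * (p * b)] gives
   [k - 1 >= (1 - 2 * eps) * (p * b)]. *)
have M_le (k : nat) : (1 - eps) * p * #|B :\ v|%:R <= k%:R -> M <= 'C(k, 2)%:R.
  move=> kge; have k_ge : (1 - eps) * (p * b) <= k%:R.
    apply: le_trans kge; rewrite mulrA ler_wpM2l// mulr_ge0//; lra.
  have pb0 : 0 <= p * b.
    by rewrite leNgt; apply/negP => /ltW /(mulr_ge0_le0 eps0); lra.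
  have pb2 : 2 <= p * b by have := ler_wpM2r pb0 eps1; lra.
  have k1 : (0 < k)%N by rewrite -(ltr0n R); nra.
  rewrite natr_bin2 /M ler_wpM2r// expr2.
  rewrite (_ : _ * _ * _ = ((1 - eps) * (p * b)) * ((1 - 2 * eps) * (p * b))); last by ring.
  by apply: ler_pM => //; [nra|nra|nra].
have eps01 : 0 <= eps <= 1 by apply/andP; split => //; lra.
apply: le_trans (le_trans (link_lower_tail p01 eps01 vW M_le) _).
  apply: le_bexp => // E _; rewrite ler_nat.
  case: ltP => // lt_t; rewrite lt0b; apply: le_lt_trans lt_t.
  by rewrite ler_nat card_link_triangles_at.
rewrite lerD2r ler_expR lerN2 !ler_wpM2l// divr_ge0// exprn_ge0//.
Qed.

(** * Probabilities in the random graph and the union bound *)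

Lemma gnp_prob_bexp (R : realType) (n : nat) (p : R) (A : pred {set {set 'I_n}}) :
  gnp_prob p A = bexp p (vpairs n) (fun E => (A E)%:R).
Proof.
rewrite /gnp_prob big_mkcondr; apply: eq_bigr => E _.
by case: (A E); rewrite ?mulr1 ?mulr0.
Qed.

(** Pointwise, [1] is at most the indicator of [A] plus the sum of the indicators of the bad events
    [Q v]. *)
Lemma gnp_prob_union_bound (R : realType) (n : nat) (p : R)
    (A : pred {set {set 'I_n}}) (Q : 'I_n -> pred {set {set 'I_n}}) :
  0 <= p <= 1 -> (forall E, (forall v, ~~ Q v E) -> A E) ->
  1 - \sum_v bexp p (vpairs n) (fun E => (Q v E)%:R) <= gnp_prob p A.
Proof.
move=> /andP[p0 p1] QA; rewrite gnp_prob_bexp lerBlDr -bexp_sum -bexpD.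
rewrite -[leLHS](bexp_cst p (vpairs n)); apply: le_bexp => // E _.
case: (boolP [exists v, Q v E]) => [/existsP[v Qv]|].
  rewrite (bigD1 v)//= Qv addrCA lerDl addr_ge0// sumr_ge0//.
by rewrite negb_exists => /forallP/QA->; rewrite lerDl sumr_ge0.
Qed.

Lemma gnp_prob_le1 (R : realType) (n : nat) (p : R) (A : pred {set {set 'I_n}}) :
  0 <= p <= 1 -> gnp_prob p A <= 1.
Proof.
move=> /andP[p0 p1]; rewrite gnp_prob_bexp -[leRHS](bexp_cst p (vpairs n)).
by apply: le_bexp => // E _; case: (A E).
Qed.

(** * Consequences of the threshold on the edge probability *)

(** With [s = Num.sqrt x], [ln x = 2 * ln s] and [ln s <= s]. *)
Lemma sqr_ln_le (R : realType) (x : R) : 1 <= x -> ln x ^+ 2 <= 4 * x.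
Proof.
move=> x1; have x0 : 0 < x by lra.
have s0 : 0 < Num.sqrt x by rewrite sqrtr_gt0.
have xs : x = Num.sqrt x ^+ 2 by rewrite sqr_sqrtr// ltW.
have lns : ln (Num.sqrt x) <= Num.sqrt x by exact/ltW/ln_sublinear.
have lns0 : 0 <= ln (Num.sqrt x).
  by rewrite ln_ge0// -sqrtr1 ler_wsqrtr.
rewrite xs lnXn// -[ln _ *+ 2]mulr_natl exprMn -natrX ler_wpM2l//.
by rewrite lerXn2r// nnegrE ltW.
Qed.

(* The second bound is the cube root of x times the first one, as
   [ln x ^+ 2 <= 4 * x]. *)
Lemma threshold_bounds (R : realType) (x p K : R) : 1 <= x -> 0 <= K ->
  4 * K * x `^ (- (2 / 3)) * ln x `^ (1 / 3) <= p ->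
  64 * K ^+ 3 * ln x <= x ^+ 2 * p ^+ 3 /\ K * ln x <= x * p.
Proof.
move=> x1 K0 hp; have x0 : 0 < x by lra.
have lx0 : 0 <= ln x by exact: ln_ge0.
have K3 : 0 <= K ^+ 3 by exact: exprn_ge0.
have q0 : 0 <= 4 * K * x `^ (- (2 / 3)) * ln x `^ (1 / 3).
  by rewrite !mulr_ge0// powR_ge0.
have p0 : 0 <= p by exact: le_trans hp.
have cube : 64 * K ^+ 3 * ln x <= x ^+ 2 * p ^+ 3.
  have : (4 * K * x `^ (- (2 / 3)) * ln x `^ (1 / 3)) ^+ 3 <= p ^+ 3.
    by rewrite lerXn2r.
  rewrite !exprMn -[(x `^ _) ^+ 3]powR_mulrn ?powR_ge0//.
  rewrite -[(ln x `^ _) ^+ 3]powR_mulrn ?powR_ge0// -!powRrM.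
  rewrite (_ : - (2 / 3) * 3%:R = - 2%:R :> R); last by field.
  rewrite (_ : 1 / 3 * 3%:R = 1 :> R); last by field.
  rewrite powRN powRr1// powR_mulrn ?(ltW x0)// => /(ler_wpM2l (exprn_ge0 2 (ltW x0))).
  apply: le_trans; rewrite le_eqVlt; apply/orP; left; apply/eqP; field.
  by rewrite gt_eqF.
(* Compare cubes: [(x * p) ^+ 3 >= 64 * K ^+ 3 * x * ln x], which is at least [(K * ln x) ^+ 3]. *)
split=> //; rewrite leNgt; apply/negP => lt_xp.
have : (x * p) ^+ 3 < (K * ln x) ^+ 3.
  by rewrite ltrXn2r// ?nnegrE ?mulr_ge0// ltW.
apply/negP; rewrite -leNgt.
have -> : (x * p) ^+ 3 = x * (x ^+ 2 * p ^+ 3) by ring.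
apply: (le_trans _ (ler_wpM2l (ltW x0) cube)).
rewrite (_ : _ ^+ 3 = K ^+ 3 * ln x * ln x ^+ 2); last by ring.
rewrite (_ : x * _ = K ^+ 3 * ln x * (64 * x)); last by ring.
rewrite ler_wpM2l ?mulr_ge0//; have := sqr_ln_le x1; lra.
Qed.

(** * The good event for a fixed number of vertices *)

Definition good_event (R : realType) (gamma : R) (n : nat) (p : R) :
    pred {set {set 'I_n}} := fun Gamma =>
  [exists G : {set {set 'I_n}},
    [&& G \subset Gamma,
        [forall v : 'I_n,
           (4 / 9 - gamma) * 'C(n, 2)%:R * p ^+ 3 <= #|triangles_at G v|%:R]
      & ~~ has_disjoint_triangles_gt G ((1 - gamma) * n%:R / 3)]].

(** [meeting set0 E] is the empty graph: it has no nonempty family of triangles, and the required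
    number of triangles is at most [0]. *)
Lemma good_event_degenerate (R : realType) (gamma : R) (n : nat) (p : R)
    (E : {set {set 'I_n}}) : 4 / 9 <= gamma -> 0 <= p -> good_event gamma p E.
Proof.
move=> g p0; apply/existsP; exists (meeting finset.set0 E); apply/and3P; split.
- by apply/subsetP => e; rewrite inE => /andP[].
- apply/forallP => v; apply: (@le_trans _ _ 0) => //.
  by rewrite mulr_le0_ge0 ?exprn_ge0// mulr_le0_ge0// subr_le0.
- apply/existsP => -[F /and4P[F0 FE trF _]].
  have := card_disjoint_triangles FE trF.
  by rewrite cards0 leqn0 muln_eq0/= cards_eq0 (negbTE F0).
Qed.

Lemma exists_set_card (T : finType) (k : nat) :
  (k <= #|T|)%N -> exists B : {set T}, #|B| = k.
Proof.
move=> /card_geqP[s [us <- _]]; exists [set x in s].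
by rewrite cardsE (card_uniqP us).
Qed.

Lemma gnp_prob_good_event (R : realType) (n : nat) (gamma p : R)
    (eps := gamma / 24) :
  0 < gamma < 4 / 9 -> 0 <= p <= 1 -> 3 / eps <= n%:R -> 1 <= ln n%:R :> R ->
  24 / eps ^+ 2 * ln n%:R <= n%:R * p ->
  288 / eps ^+ 2 * ln n%:R <= n%:R ^+ 2 * p ^+ 3 ->
  1 - 2 / n%:R <= gnp_prob p (@good_event R gamma n p).
Proof.
move=> /andP[g0 g1] p01 nlarge ln1 np n2p3; have /andP[p0 p1] := p01.
have gE : gamma = 24 * eps by rewrite /eps; field.
have e0 : 0 < eps by rewrite divr_gt0.
have e1 : 54 * eps < 1 by lra.
have e20 : 0 < eps ^+ 2 by rewrite exprn_gt0.
have n0 : 0 < n%:R :> R by apply: lt_le_trans nlarge; rewrite divr_gt0.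
have en : 3 <= eps * n%:R by move: nlarge; rewrite ler_pdivrMr// mulrC.
(* Twice the allowed number of disjoint triangles; [B] has the integer part of [y] as its size. *)
set y := 2 * (1 - gamma) * n%:R / 3.
have y0 : 0 <= y by rewrite divr_ge0// mulr_ge0// ?ltW//; lra.
have /andP[t_le t_gt] := truncn_itv y0.
have [B cB] : exists B : {set 'I_n}, #|B| = Num.truncn y.
  apply: exists_set_card; rewrite card_ord -(ler_nat R).
  apply: le_trans t_le _; rewrite /y; have := mulr_ge0 (ltW g0) (ltW n0); lra.
(* [y] is [2 / 3 * (1 - 24 * eps) * n]; the further [2 / 3 * eps * n >= 2] pays for the truncation
   and for the vertex [v]. *)
set b := 2 / 3 * (1 - 25 * eps) * n%:R.
have bB : b <= #|B|%:R - 1.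
  by move: t_gt; rewrite cB -natr1 /y /b gE; lra.
have bn : n%:R / 3 <= b.
  have : 0 <= (1 - 54 * eps) * n%:R by rewrite mulr_ge0// ?subr_ge0 ltW.
  rewrite /b; lra.
have pb : n%:R * p / 3 <= p * b by have := ler_wpM2l p0 bn; lra.
have np' : 24 * ln n%:R <= eps ^+ 2 * (n%:R * p).
  by move: np; rewrite mulrAC ler_pdivrMr// [leRHS]mulrC.
have n2p3' : 288 * ln n%:R <= eps ^+ 2 * (n%:R ^+ 2 * p ^+ 3).
  by move: n2p3; rewrite mulrAC ler_pdivrMr// [leRHS]mulrC.
have pb0 : 0 <= p * b by apply: le_trans pb; rewrite divr_ge0// mulr_ge0// ltW.
have epb : 1 <= eps * (p * b).
  have : eps ^+ 2 * (n%:R * p) <= 3 * (eps * (p * b)).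
    have -> : eps ^+ 2 * (n%:R * p) = 3 * (eps * (eps * (n%:R * p / 3))) by field.
    rewrite ler_wpM2l// (ler_wpM2l (ltW e0))//; apply: le_trans pb.
    rewrite -[leRHS]mul1r ler_wpM2r//; last by lra.
    by rewrite divr_ge0// mulr_ge0// ltW.
  lra.
have eps12 : 0 <= eps <= 1 / 2 by apply/andP; split; lra.
pose M := (1 - eps) * (1 - 2 * eps) * (p * b) ^+ 2 / 2.
have M_ge : n%:R ^+ 2 * p ^+ 2 / 36 <= M.
  have h1 : 1 / 2 <= (1 - eps) * (1 - 2 * eps) by nra.
  have h2 : (n%:R * p / 3) ^+ 2 <= (p * b) ^+ 2.
    by rewrite lerXn2r// nnegrE divr_ge0// mulr_ge0// ltW.
  have h3 := ler_wpM2r (sqr_ge0 (p * b)) h1.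
  have h4 : (n%:R * p / 3) ^+ 2 = n%:R ^+ 2 * p ^+ 2 / 9 by field.
  rewrite /M; lra.
(* The constants [24 = 2 * 12] and [288 = 2 * 144] make both exponents at least [2 * ln n]: the
   denominators are [4 * 3] from [pb] and [4 * 36] from [M_ge]. *)
have tail1 : expR (- (eps ^+ 2 / 4 * (p * b))) <= (n%:R ^+ 2)^-1 :> R.
  rewrite -[n%:R]lnK ?posrE// -expRM_natl -expRN ler_expR lerN2.
  have := ler_wpM2l (ltW e20) pb; lra.
have tail2 : expR (- (eps ^+ 2 / 4 * (p * M))) <= (n%:R ^+ 2)^-1 :> R.
  rewrite -[n%:R in leRHS]lnK ?posrE// -expRM_natl -expRN ler_expR lerN2.
  have h : n%:R ^+ 2 * p ^+ 3 / 36 <= p * M.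
    have := ler_wpM2l p0 M_ge.
    by rewrite (_ : p * (_ / _) = n%:R ^+ 2 * p ^+ 3 / 36)//; field.
  have := ler_wpM2l (ltW e20) h; lra.
pose Q (v : 'I_n) (E : {set {set 'I_n}}) :=
  #|triangles_at (meeting B E) v|%:R < (1 - eps) * p * M.
apply: le_trans (@gnp_prob_union_bound R n p _ Q p01 _).
  rewrite lerD2l lerN2.
  apply: (@le_trans _ _ (\sum_(v < n) 2 / n%:R ^+ 2)).
    apply: ler_sum => v _; apply: le_trans (vertex_tail v p01 eps12 epb bB) _.
    by apply: le_trans (lerD tail1 tail2) _; rewrite -mulr2n mulr_natl.
  rewrite sumr_const card_ord -mulr_natl le_eqVlt.
  by apply/orP; left; apply/eqP; field; rewrite gt_eqF.
move=> E QE; apply/existsP; exists (meeting B E); apply/and3P; split.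
- by apply/subsetP => e; rewrite inE => /andP[].
- apply/forallP => v; have := QE v; rewrite -leNgt; apply: le_trans.
  (* The right side is at least [4 / 9 * (1 - 4 * eps) * (1 - 50 * eps)], hence at least [4 / 9 * (1
     - 54 * eps) = 4 / 9 - 24 * eps]; this is where [eps = gamma / 24] comes from. *)
  have c1 : 4 / 9 - gamma
      <= (1 - eps) ^+ 2 * (1 - 2 * eps) * (2 / 3 * (1 - 25 * eps)) ^+ 2.
    have a1 : 1 - 4 * eps <= (1 - eps) ^+ 2 * (1 - 2 * eps) by nra.
    have a2 := sqr_ge0 (2 / 3 * (1 - 25 * eps)).
    have := ler_wpM2r a2 a1; rewrite gE; nra.
  have c2 : 'C(n, 2)%:R <= n%:R ^+ 2 / 2 :> R by rewrite natr_bin2; lra.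
  rewrite (_ : (1 - eps) * p * M = (1 - eps) ^+ 2 * (1 - 2 * eps) *
     (2 / 3 * (1 - 25 * eps)) ^+ 2 * (n%:R ^+ 2 / 2) * p ^+ 3); last first.
    by rewrite /M /b; field.
  rewrite ler_wpM2r ?exprn_ge0//.
  apply: ler_pM => //; lra.
- apply/existsP => -[F /and4P[_ FE trF]]; apply/negP; rewrite -leNgt.
  have := card_disjoint_triangles FE trF; rewrite -(ler_nat R) natrM cB.
  move: t_le; rewrite /y; lra.
Qed.

(** * Choice of the constant and passage to the limit *)

Theorem theorem3p1 (R : realType) (gamma : R) (gamma_gt0 : 0 < gamma) :
  exists2 C : R, 0 < C &
    forall p : nat -> R,
      (forall n : nat, 0 <= p n <= 1) ->
      (\forall n \near \oo%classic,
         C * n%:R `^ (- (2 / 3)) * ln n%:R `^ (1 / 3) <= p n) ->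
      whp p (fun (n : nat) (Gamma : {set {set 'I_n}}) =>
        [exists G : {set {set 'I_n}},
          [&& G \subset Gamma,
              [forall v : 'I_n,
                 (4 / 9 - gamma) * 'C(n, 2)%:R * p n ^+ 3
                   <= #|triangles_at G v|%:R]
            & ~~ has_disjoint_triangles_gt G ((1 - gamma) * n%:R / 3)]]).
Proof.
have [g_ge|g_lt] := lerP (4 / 9) gamma.
  (* Every graph lies in the event, so its probability is constantly [1]. *)
  exists 1 => // p p01 _; apply: cvg_near_cst; apply: nearW => n.
  have /andP[p0 _] := p01 n; rewrite gnp_prob_bexp -[RHS](bexp_cst (p n) (vpairs n)).
  apply: eq_bigr => E _; have := good_event_degenerate E g_ge p0.
  by rewrite /good_event => ->.
pose eps := gamma / 24; pose K := 24 / eps ^+ 2.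
have e0 : 0 < eps by rewrite divr_gt0.
have e1 : eps < 1 by rewrite /eps; lra.
have K1 : 24 <= K.
  by rewrite ler_pdivlMr ?exprn_gt0// ler_piMr// exprn_ile1// ltW.
exists (4 * K); first by lra.
move=> p p01 p_ge; apply/cvgrPdist_le => d d0; near=> n.
have g01 : 0 < gamma < 4 / 9 by rewrite gamma_gt0.
have n_e : expR 1 <= n%:R :> R by near: n; exact: nbhs_infty_ger.
have n1 : 1 <= n%:R :> R by apply: le_trans n_e; have := expR_ge1Dx (1 : R); lra.
have ln1 : 1 <= ln n%:R :> R by rewrite -[leLHS]expRK ler_ln ?posrE ?expR_gt0//; lra.
have K0 : 0 <= K by lra.
have pn : 4 * K * n%:R `^ (- (2 / 3)) * ln n%:R `^ (1 / 3) <= p n by near: n.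
have [cube lin] := threshold_bounds n1 K0 pn.
have nlarge : 3 / eps <= n%:R by near: n; exact: nbhs_infty_ger.
(* [K] is fitted to the bound on [n * p]; the cubic one needs only [12 * K], well below
   [64 * K ^+ 3] as [K >= 24]. *)
have n2p3 : 288 / eps ^+ 2 * ln n%:R <= n%:R ^+ 2 * p n ^+ 3.
  apply: le_trans cube; rewrite ler_wpM2r//; first by lra.
  have -> : 288 / eps ^+ 2 = 12 * K by rewrite /K; field; rewrite gt_eqF.
  nra.
have := gnp_prob_good_event g01 (p01 n) nlarge ln1 lin n2p3.
have := gnp_prob_le1 (@good_event R gamma n (p n)) (p01 n).
set P := gnp_prob _ _ => P1 P2; change (`|1 - P| <= d).
rewrite ger0_norm ?subr_ge0//.
have : 2 / n%:R <= d.
  rewrite ler_pdivrMr; last by lra.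
  rewrite mulrC -ler_pdivrMr//; near: n; exact: nbhs_infty_ger.
lra.
Unshelve. all: by end_near.
Qed.
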